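(* Let $G=(V,E,C)$ be a Schreier graph with associated Lie algebra $\mathfrak{n}_G$. Let $\beta$ be the number of distinct equivalence classes in the partition of $V$ with respect to the relation $\sim$ (connection by a 2-path sequence), with the vertices labeled so that $v_1,v_2,\dots,v_\beta$ represent the distinct equivalence classes. Define $\xi_i=\sum_{v_j\in[v_i]}v_j$ for each $i=1,\dots,\beta$. Then the set $\{\xi_i\}_{i=1}^{\beta}$ forms a basis for the abelian factor of $\mathfrak{n}_G$.
   Context: A directed edge-labeled graph $G=(V,E,C)$ is a finite connected directed graph (loops and multiple edges allowed) with vertex set $V=\{v_1,\dots,v_n\}$ and edge set $E$, together with a surjective labeling $c:E\to C=\{Z_1,\dots,Z_p\}$ (labels may be repeated). The Lie algebra $\mathfrak{n}_G$: as a real vector space $\mathfrak{n}_G=\mathfrak{v}\oplus\mathfrak{w}$, where $\mathfrak{v}$ has basis $V$ and $\mathfrak{w}$ has basis $C$. The bracket is bilinear and skew-symmetric with $[v_i,v_j]=\sum_{\ell}(\epsilon_\ell-\epsilon'_\ell)Z_\ell$, where $\epsilon_\ell=1$ if there is an edge from $v_i$ to $v_j$ labeled $Z_\ell$ and $0$ otherwise, and $\epsilon'_\ell=1$ if there is an edge from $v_j$ to $v_i$ labeled $Z_\ell$ and $0$ otherwise; all other brackets of basis elements are zero. It is a standing assumption that the derived algebra is $[\mathfrak{n}_G,\mathfrak{n}_G]=\mathfrak{w}$. The abelian factor of $\mathfrak{n}_G$ is the unique subspace $\mathfrak{a}\subseteq\mathfrak{v}$ such that the center satisfies $\mathcal{Z}(\mathfrak{n}_G)=[\mathfrak{n}_G,\mathfrak{n}_G]\oplus\mathfrak{a}$.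 A Schreier graph is a directed edge-labeled graph, all of whose vertices have the same even degree, such that for each vertex $v$ and each label $Z\in C$ there is exactly one edge labeled $Z$ starting at $v$ and exactly one edge labeled $Z$ terminating at $v$ (these may be the same edge, a loop). For $Z\in C$, $\alpha(Z)$ is the permutation of $V$ with $\alpha(Z)v=w$ iff there is an edge from $v$ to $w$ labeled $Z$; $\alpha(Z^{-1})=\alpha(Z)^{-1}$, and $\alpha$ is extended to products by $\alpha(Z_1Z_2)v=\alpha(Z_1)(\alpha(Z_2)v)$. A 2-path sequence is a product $(Z_\ell^{\pm1})^2\cdots(Z_2^{\pm1})^2(Z_1^{\pm1})^2$ with $Z_1,\dots,Z_\ell\in C$ not necessarily distinct (here $Z_1,\dots,Z_\ell$ denote arbitrary labels, signs arbitrary). Define $v_i\sim v_j$ if there is a 2-path sequence $T$ with $v_j=\alpha(T)v_i$. This is an equivalence relation on $V$; $[v_i]$ denotes the class of $v_i$. *)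

(* Defs.v *)
From HB Require Import structures.
From mathcomp Require Import all_boot all_order all_algebra all_fingroup.
From mathcomp Require Import boolp reals.

Set Implicit Arguments.
Unset Strict Implicit.
Unset Printing Implicit Defensive.

Import Order.TTheory GRing.Theory Num.Theory.
Local Open Scope ring_scope.

(* The edges form a type of their own, so that loops and multiple edges are
   allowed; connectedness is that of the underlying undirected graph. *)
Record elgraph := ELGraph {
  vertex : finType;
  edge : finType;
  label : finType;
  source : edge -> vertex;
  target : edge -> vertex;
  lab : edge -> label;
  lab_surj : forall Z, exists e, lab e = Z;
  elgraph_connected : forall u v : vertex,
    connect (fun x y => [exists e,
       ((source e == x) && (target e == y))
       || ((source e == y) && (target e == x))]) u v
}.

Definition has_edge (G : elgraph) (Z : label G) (u v : vertex G) : bool :=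
  [exists e, [&& source e == u, target e == v & lab e == Z]].

(* A loop counts twice. *)
Definition degree (G : elgraph) (v : vertex G) : nat :=
  (#|[set e : edge G | source e == v]| + #|[set e : edge G | target e == v]|)%N.

Record schreierGraph := SchreierGraph {
  elgraph_of :> elgraph;
  schreier_degree : exists2 d, ~~ odd d &
    forall v : vertex elgraph_of, degree v = d;
  schreier_out : forall (v : vertex elgraph_of) (Z : label elgraph_of),
    #|[set e : edge elgraph_of | (source e == v) && (lab e == Z)]| = 1%N;
  schreier_in : forall (v : vertex elgraph_of) (Z : label elgraph_of),
    #|[set e : edge elgraph_of | (target e == v) && (lab e == Z)]| = 1%N
}.

Section LieAlgebra.
Variables (R : realType) (G : elgraph).

(* The real vector space with basis V and C. *)
Notation nG := {ffun vertex G + label G -> R^o}.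

Definition bvec (b : vertex G + label G) : nG := [ffun c => (c == b)%:R].

Definition vspan : {vspace nG} := <<[seq bvec (inl v) | v : vertex G]>>%VS.
Definition wspan : {vspace nG} := <<[seq bvec (inr Z) | Z : label G]>>%VS.

Definition basis_bracket (a b : vertex G + label G) : nG :=
  match a, b with
  | inl u, inl v =>
      \sum_(Z : label G)
        ((has_edge Z u v)%:R - (has_edge Z v u)%:R : R) *: bvec (inr Z)
  | _, _ => 0
  end.

Definition bracket (x y : nG) : nG :=
  \sum_a \sum_b ((x a : R) * (y b : R)) *: basis_bracket a b.

Definition derived : {vspace nG} :=
  <<[seq bracket x y | x <- vbasis fullv, y <- vbasis fullv]>>%VS.

Definition in_center (x : nG) : Prop := forall y, bracket x y = 0.

Definition is_abelian_factor (A : {vspace nG}) : Prop :=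
  [/\ (A <= vspan)%VS,
      directv (derived + A)
    & forall x, in_center x <-> x \in (derived + A)%VS].

Lemma bracket_linearl y : linear (bracket^~ y).
Proof.
move=> k x x'; rewrite /bracket scaler_sumr -big_split; apply: eq_bigr => a _ /=.
rewrite scaler_sumr -big_split; apply: eq_bigr => b _ /=.
by rewrite !ffunE scalerA -scalerDl mulrDl mulrA.
Qed.

Lemma basis_bracketC a b : basis_bracket a b = - basis_bracket b a.
Proof.
case: a b => [u|Z] [v|Z'] /=; rewrite ?oppr0 // -sumrN.
by apply: eq_bigr => Z _; rewrite -scaleNr opprB.
Qed.

Lemma bracketC x y : bracket x y = - bracket y x.
Proof.
rewrite /bracket exchange_big -sumrN; apply: eq_bigr => b _ /=.
rewrite -sumrN; apply: eq_bigr => a _.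
by rewrite basis_bracketC scalerN mulrC.
Qed.

Lemma bracket_linearr x : linear (bracket x).
Proof.
move=> k y y'; rewrite bracketC bracket_linearl.
by rewrite (bracketC x y) (bracketC x y') opprD scalerN.
Qed.

Lemma bracket_bvec a b : bracket (bvec a) (bvec b) = basis_bracket a b.
Proof.
rewrite /bracket (bigD1 a) //= [X in _ + X]big1 => [|c /negPf ca].
  rewrite addr0 (bigD1 b) //= big1 => [|c /negPf cb].
    by rewrite !ffunE !eqxx mulr1 scale1r addr0.
  by rewrite !ffunE cb mulr0 scale0r.
by apply: big1 => d _; rewrite !ffunE ca mul0r scale0r.
Qed.

Lemma bvec_sum (x : nG) : x = \sum_b (x b : R) *: bvec b.
Proof.
apply/ffunP => c; rewrite sum_ffunE (bigD1 c) //= big1 => [|b].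
  by rewrite !ffunE eqxx addr0 [RHS]mulr1.
by rewrite eq_sym !ffunE => /negPf ->; rewrite scaler0.
Qed.

Lemma bracket0l y : bracket 0 y = 0.
Proof.
by apply: big1 => a _; apply: big1 => b _; rewrite ffunE mul0r scale0r.
Qed.

Lemma bracketZl k x y : bracket (k *: x) y = k *: bracket x y.
Proof. by rewrite -[k *: x]addr0 bracket_linearl bracket0l addr0. Qed.

Lemma bracket_suml I (r : seq I) (F : I -> nG) y :
  bracket (\sum_(i <- r) F i) y = \sum_(i <- r) bracket (F i) y.
Proof.
apply: (big_morph (bracket^~ y)) => [x x'|]; last exact: bracket0l.
by rewrite -[x]scale1r bracket_linearl !scale1r.
Qed.

Lemma derivedP (U : {vspace nG}) :
  (derived <= U)%VS <-> forall x y, bracket x y \in U.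
Proof.
split=> [sDU x y|DU].
  apply: (subvP sDU).
  have lin (z : nG) : z = \sum_i coord (vbasis fullv) i z *: (vbasis fullv)`_i.
    exact/coord_vbasis/memvf.
  rewrite (lin x) bracket_suml; apply: memv_suml => i _; rewrite bracketZl memvZ //.
  rewrite bracketC (lin y) bracket_suml memvN; apply: memv_suml => j _.
  rewrite bracketZl memvZ // bracketC memvN memv_span //.
  by apply/allpairsP; exists ((vbasis fullv)`_i, (vbasis fullv)`_j);
     rewrite !mem_nth ?size_tuple.
by apply/span_subvP => _ /allpairsP[[x y] [_ _ ->]].
Qed.

Lemma bvec_vspan u : bvec (inl u) \in vspan.
Proof. by apply: memv_span; apply/imageP; exists u. Qed.

Lemma bvec_wspan Z : bvec (inr Z) \in wspan.
Proof. by apply: memv_span; apply/imageP; exists Z. Qed.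

Lemma wspan_eq0 (x : nG) v : x \in wspan -> x (inl v) = 0.
Proof.
rewrite /wspan span_def big_image => /memv_sumP[F Fx ->]; rewrite sum_ffunE.
apply: big1 => Z _; have /vlineP[k ->] := Fx Z isT.
by rewrite !ffunE scaler0.
Qed.

Lemma vspan_eq0 (x : nG) Z : x \in vspan -> x (inr Z) = 0.
Proof.
rewrite /vspan span_def big_image => /memv_sumP[F Fx ->]; rewrite sum_ffunE.
apply: big1 => v _; have /vlineP[k ->] := Fx v isT.
by rewrite !ffunE scaler0.
Qed.

Lemma vwspan_direct : (vspan :&: wspan = 0)%VS.
Proof.
apply/eqP; rewrite -subv0; apply/subvP => x; rewrite memv_cap => /andP[xv xw].
rewrite memv0; apply/eqP/ffunP => -[v|Z]; rewrite ffunE.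
  exact: wspan_eq0.
exact: vspan_eq0.
Qed.

Lemma vwspan_full : (vspan + wspan = fullv)%VS.
Proof.
apply/eqP; rewrite eqEsubv subvf; apply/subvP => x _; rewrite (bvec_sum x).
apply: memv_suml => -[v|Z] _; rewrite memvZ //.
  by apply: (subvP (addvSl _ _)); rewrite bvec_vspan.
by apply: (subvP (addvSr _ _)); rewrite bvec_wspan.
Qed.

Lemma bracket_wspan (x y : nG) : x \in wspan -> bracket x y = 0.
Proof.
move=> xw; rewrite /bracket big1 // => -[v|Z] _; apply: big1 => b _.
  by rewrite wspan_eq0 // mul0r scale0r.
by rewrite /= scaler0.
Qed.

Lemma bracket_in_wspan (x y : nG) : bracket x y \in wspan.
Proof.
apply: memv_suml => a _; apply: memv_suml => b _; rewrite memvZ //.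
case: a b => [u|Z] [v|Z'] /=; rewrite ?mem0v //.
by apply: memv_suml => Z _; rewrite memvZ // bvec_wspan.
Qed.

Lemma bracket_jacobi (x y z : nG) :
  bracket x (bracket y z) + bracket y (bracket z x) + bracket z (bracket x y)
  = 0.
Proof.
have br0 u v w : bracket u (bracket v w) = 0.
  by rewrite bracketC bracket_wspan ?oppr0 ?bracket_in_wspan.
by rewrite !br0 !addr0.
Qed.

Lemma abelian_factor_exists_unique :
  derived = wspan -> exists! A, is_abelian_factor A.
Proof.
move=> D; pose f (x : nG) : {ffun vertex G + label G -> nG} :=
  [ffun b => bracket x (bvec b)].
have linf : linear f.
  by move=> k x y; apply/ffunP => b; rewrite !ffunE bracket_linearl.
pose F := linfun (HB.pack_for {linear nG -> _} f
  (GRing.isLinear.Build _ _ _ _ _ linf)).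
have centP x : in_center x <-> x \in lker F.
  rewrite memv_ker lfunE /=; split=> [xc|/eqP fx0 y].
    by apply/eqP/ffunP => b; rewrite !ffunE xc.
  rewrite bracketC (bvec_sum y) bracket_suml big1 ?oppr0 // => b _.
  have := congr1 (fun g : {ffun _ -> nG} => g b) fx0; rewrite !ffunE => xb.
  by rewrite bracketZl bracketC xb oppr0 scaler0.
have wF : (wspan <= lker F)%VS.
  by apply/subvP => x xw; apply/centP => y; apply: bracket_wspan.
exists (vspan :&: lker F)%VS; split; first split.
- exact: capvSl.
- by apply/directv_addP; rewrite D capvA (capvC wspan) vwspan_direct cap0v.
- by move=> x; rewrite D vspace_modl // addvC vwspan_full capfv.
move=> A [sAv _ Ac].
have -> : lker F = (wspan + A)%VS.
  apply/vspaceP => x; apply/idP/idP => [/centP/Ac|xA].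
    by rewrite D.
  by apply/centP/Ac; rewrite D.
by rewrite -vspace_modr // vwspan_direct add0v.
Qed.

End LieAlgebra.

Section Schreier.
Variable G : schreierGraph.

Definition alpha_fun (Z : label G) (v : vertex G) : vertex G :=
  if [pick e : edge G | (source e == v) && (lab e == Z)] is Some e
  then target e else v.

Lemma alpha_funP Z u v : (alpha_fun Z u == v) = has_edge Z u v.
Proof.
have /eqP/cards1P[e0 He0] := @schreier_out G u Z.
have out e : ((source e == u) && (lab e == Z)) = (e == e0).
  by rewrite -[RHS]in_set1 -He0 inE.
rewrite /alpha_fun; case: pickP => [e|/(_ e0)]; rewrite out ?eqxx //.
move=> /eqP->; apply/eqP/existsP => [<-|[e']].
  by exists e0; have /andP[-> ->] := etrans (out e0) (eqxx _); rewrite eqxx.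
by case/and3P=> su /eqP<- lZ; have := out e'; rewrite su lZ => /esym/eqP->.
Qed.

Lemma alpha_fun_inj Z : injective (alpha_fun Z).
Proof.
move=> u u' /eqP; rewrite eq_sym alpha_funP => /existsP[e /and3P[/eqP su tu lu]].
have : has_edge Z u (alpha_fun Z u) by rewrite -alpha_funP.
case/existsP=> e' /and3P[/eqP su' tu' lu'].
have /eqP/cards1P[e0 He0] := @schreier_in G (alpha_fun Z u) Z.
have inn d : target d == alpha_fun Z u -> lab d == Z -> d = e0.
  by move=> td ld; apply/set1P; rewrite -He0 inE td.
by have ee := inn e tu lu; have ee' := inn e' tu' lu'; rewrite -su' -su ee ee'.
Qed.

Definition alpha (Z : label G) : {perm vertex G} := perm (@alpha_fun_inj Z).

Lemma alphaP Z u v : alpha Z u = v <-> has_edge Z u v.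
Proof. by rewrite permE -alpha_funP; split=> /eqP. Qed.

(* The letter (Z, true) stands for Z and (Z, false) for its inverse. *)
Definition alpha_letter (x : label G * bool) : {perm vertex G} :=
  if x.2 then alpha x.1 else ((alpha x.1)^-1)%g.

(* Words are written as products are: the rightmost letter acts first. *)
Definition alpha_word (T : seq (label G * bool)) (v : vertex G) : vertex G :=
  foldr (fun x u => alpha_letter x u) v T.

(* The empty product is allowed; this only matters when there is no label,
   where it is what makes the relation below reflexive. *)
Definition two_path_sequence (T : seq (label G * bool)) : Prop :=
  exists s, T = flatten [seq [:: x; x] | x <- s].

Definition two_path_rel (u v : vertex G) : bool :=
  `[< exists2 T, two_path_sequence T & v = alpha_word T u >].

Lemma alpha_word_cat S T v :
  alpha_word (S ++ T) v = alpha_word S (alpha_word T v).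
Proof. by rewrite /alpha_word foldr_cat. Qed.

Lemma two_path_rel_equiv : equivalence_rel two_path_rel.
Proof.
have refl u : two_path_rel u u by apply/asboolP; exists [::] => //; exists [::].
have trans u v w : two_path_rel u v -> two_path_rel v w -> two_path_rel u w.
  move=> /asboolP[S [s ->] ->] /asboolP[T [t ->] ->]; apply/asboolP.
  exists (flatten [seq [:: x; x] | x <- t ++ s]); first by exists (t ++ s).
  by rewrite map_cat flatten_cat alpha_word_cat.
have sym u v : two_path_rel u v -> two_path_rel v u.
  move=> /asboolP[_ [s ->] ->] {v}; elim: s => [|[Z b] s IHs] /=.
    exact: refl.
  apply: trans IHs; apply/asboolP.
  exists [:: (Z, ~~ b); (Z, ~~ b)]; first by exists [:: (Z, ~~ b)].
  by case: b; rewrite /alpha_letter /= ?permK ?permKV.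
move=> u v w; split=> // uv; apply/idP/idP; last exact: trans.
exact/trans/sym.
Qed.

Definition two_path_class (v : vertex G) : {set vertex G} :=
  [set u | two_path_rel v u].

Definition two_path_classes : {set {set vertex G}} :=
  [set two_path_class v | v : vertex G].

Definition beta : nat := #|two_path_classes|.

Lemma beta_le : (beta <= #|vertex G|)%N.
Proof. exact: leq_imset_card. Qed.

Definition xi (R : realType) (v : vertex G) :
    {ffun vertex G + label G -> R^o} :=
  \sum_(u in two_path_class v) bvec R (inl u).

End Schreier.

(* Main.v *)
Require Import Defs.
From mathcomp Require Import all_boot all_order all_algebra all_fingroup.
From mathcomp Require Import boolp reals.

Set Implicit Arguments.
Unset Strict Implicit.
Unset Printing Implicit Defensive.

Import GRing.Theory.
Local Open Scope ring_scope.

(** The abelian factor is the set of central elements of the span of the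
    vertices, so the point is to recognise centrality.  Since each label [Z]
    permutes the vertices, the [Z]-coordinate of the bracket of [x] with the
    vertex [u] is the coefficient of [x] at the [Z]-predecessor of [u] minus
    its coefficient at the [Z]-successor of [u] ([bracket_bvec_label]).  All of
    these vanish exactly when the coefficients of [x] are invariant under every
    [alpha Z ^ 2] ([in_centerP]).  The squares [alpha Z ^ 2] and their inverses
    are the generators of the 2-path relation, so centrality says that the
    coefficients of [x] are constant on the 2-path classes
    ([in_center_two_pathP]).  Functions constant on the blocks of a partition
    have the indicators of the blocks as a basis; the indicator of the class of
    [v] is [xi v]. *)

Section Bracket.
Variables (R : realType) (G : schreierGraph).
Notation nG := {ffun vertex G + label G -> R^o}.

(** Exactly one edge labeled [Z] enters [u] and exactly one leaves it, so in the
    sum over the vertices [w] the edge from [w] to [u] survives only for the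
    predecessor of [u], and the edge from [u] to [w] only for its successor.
    When these coincide the two terms cancel, as they do in the bracket. *)
Lemma bracket_bvec_label (x : nG) (Z : label G) (u : vertex G) :
  bracket x (bvec R (inl u)) (inr Z)
    = x (inl ((alpha Z)^-1%g u)) - x (inl (alpha Z u)).
Proof.
have edgeE a b : has_edge Z a b = (b == alpha Z a).
  by rewrite eq_sym; apply/idP/eqP => /alphaP.
have coefE w : (basis_bracket R (inl w) (inl u) : nG) (inr Z)
    = (w == (alpha Z)^-1%g u)%:R - (w == alpha Z u)%:R.
  rewrite /= sum_ffunE (bigD1 Z) //= big1 => [|Z' /negPf ZZ']; last first.
    by rewrite !ffunE eq_sym (inj_eq inr_inj) ZZ' scaler0.
  rewrite !ffunE eqxx addr0 !edgeE [LHS]mulr1.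
  by rewrite -(inj_eq (@perm_inj _ (alpha Z)) w ((alpha Z)^-1%g u)) permKV (eq_sym u).
have sum1E a : \sum_w (x (inl w) : R) *: ((w == a)%:R : R^o) = x (inl a).
  rewrite (bigD1 a) //= eqxx big1 => [|w /negPf->]; last by rewrite scaler0.
  by rewrite addr0 [LHS]mulr1.
rewrite [in LHS](bvec_sum x) bracket_suml sum_ffunE big_sumType /=.
rewrite [X in _ + X]big1 ?addr0 => [|Z' _]; last first.
  by rewrite bracketZl bracket_bvec scaler0 ffunE.
under eq_bigr => w _ do rewrite bracketZl bracket_bvec ffunE coefE scalerBr.
by rewrite sumrB !sum1E.
Qed.

(** Brackets lie in the span of the labels, so centrality is the vanishing of
    every [Z]-coordinate; moving one step along [Z] turns the equality of the
    coefficients before and after a vertex into invariance under two steps. *)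
Lemma in_centerP (x : nG) :
  in_center x
    <-> forall Z (u : vertex G), x (inl (alpha Z (alpha Z u))) = x (inl u).
Proof.
split=> [xc Z u|xinv y].
  apply/esym/subr0_eq; rewrite -[in x (inl u)](permK (alpha Z) u).
  by rewrite -bracket_bvec_label xc ffunE.
rewrite bracketC (bvec_sum y) bracket_suml big1 ?oppr0 // => -[u|Z] _.
  rewrite bracketZl bracketC; apply/eqP.
  rewrite scaler_eq0 oppr_eq0; apply/orP; right.
  apply/eqP/ffunP => -[w|Z]; rewrite [RHS]ffunE.
    exact/wspan_eq0/bracket_in_wspan.
  by rewrite bracket_bvec_label -[in alpha Z u](permKV (alpha Z) u) xinv subrr.
by rewrite bracketZl bracket_wspan ?scaler0 // bvec_wspan.
Qed.

End Bracket.

Section TwoPath.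
Variable G : schreierGraph.

Lemma two_path_rel_sq Z (u : vertex G) : two_path_rel u (alpha Z (alpha Z u)).
Proof.
by apply/asboolP; exists [:: (Z, true); (Z, true)] => //; exists [:: (Z, true)].
Qed.

(** It is enough to test invariance on positive letters: the square of an
    inverse letter is undone by the square of the letter. *)
Lemma two_path_rel_invariant (T : Type) (f : vertex G -> T) :
  (forall Z u, f (alpha Z (alpha Z u)) = f u) ->
  forall u w, two_path_rel u w -> f w = f u.
Proof.
move=> finv u w /asboolP[_ [s ->] ->] {w}.
elim: s => [//|[Z [|]] s IHs] /=; rewrite /alpha_letter /= -IHs ?finv //.
set w := alpha_word _ _.
by rewrite -[in RHS](permKV (alpha Z) w) -[in RHS](permKV (alpha Z) (_ w)) finv.
Qed.

Lemma in_two_path_class (u w : vertex G) :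
  (w \in two_path_class u) = (two_path_class u == two_path_class w).
Proof.
have eqv a b c := @two_path_rel_equiv G a b c.
rewrite inE; apply/idP/eqP => [uw|/setP/(_ w)].
  by apply/setP => t; rewrite !inE (eqv u w t).2.
by rewrite !inE (eqv w w w).1.
Qed.

Variable R : realType.
Notation nG := {ffun vertex G + label G -> R^o}.

Lemma in_center_two_pathP (x : nG) :
  in_center x
    <-> forall u w : vertex G, two_path_rel u w -> x (inl w) = x (inl u).
Proof.
rewrite in_centerP; split=> [|xconst Z u]; first exact: two_path_rel_invariant.
exact/xconst/two_path_rel_sq.
Qed.

Lemma xi_inl (u w : vertex G) :
  xi R u (inl w) = (two_path_class u == two_path_class w)%:R.
Proof.
rewrite /xi sum_ffunE -in_two_path_class.
under eq_bigr => t _ do rewrite ffunE (inj_eq inl_inj).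
have [wu|wu] := boolP (w \in _); last first.
  by apply: big1 => t tu; case: eqP wu tu => // -> /negPf->.
by rewrite (bigD1 w) //= eqxx big1 ?addr0 // => t /andP[_]; rewrite eq_sym => /negPf->.
Qed.

Lemma xi_vspan (u : vertex G) : xi R u \in vspan R G.
Proof. by apply: memv_suml => w _; apply: bvec_vspan. Qed.

Lemma xi_in_center (u : vertex G) : in_center (xi R u).
Proof.
apply/in_center_two_pathP => a b ab; rewrite !xi_inl.
have : b \in two_path_class a by rewrite inE.
by rewrite in_two_path_class => /eqP->.
Qed.

(** A central element of the derived algebra plus [A] that lies in the span of
    the vertices has no component on the labels, hence lies in [A]. *)
Lemma mem_abelian_factor (A : {vspace nG}) (x : nG) :
  derived R G = wspan R G -> is_abelian_factor A ->
  x \in A <-> x \in vspan R G /\ in_center x.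
Proof.
move=> hD [sAv _ Ac]; split=> [xA|[xv /Ac]].
  by split; [exact: (subvP sAv) | apply/Ac; exact: (subvP (addvSr _ _))].
rewrite hD => /memv_addP[w ww [a aA def_x]].
suff w0 : w = 0 by rewrite def_x w0 add0r.
apply/eqP; rewrite -memv0 -(vwspan_direct R G) memv_cap ww andbT.
by rewrite -(addrK a w) -def_x memvB // (subvP sAv).
Qed.

End TwoPath.

Theorem theorem5p8 (R : realType) (G : schreierGraph)
  (hD : derived R G = wspan R G)
  (v : 'I_#|vertex G| -> vertex G) (v_bij : bijective v)
  (v_repr : [set two_path_class (v (widen_ord (beta_le G) i)) | i : 'I_(beta G)]
            = two_path_classes G)
  (A : {vspace {ffun vertex G + label G -> R^o}})
  (hA : is_abelian_factor A) :
  basis_of A [seq xi R (v (widen_ord (beta_le G) i)) | i : 'I_(beta G)].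
Proof.
pose r i := v (widen_ord (beta_le G) i).
(* There are as many indices as classes, so representing all the classes
   forces the representatives to be pairwise inequivalent. *)
have cls_inj : injective (fun i => two_path_class (r i)).
  have /imset_injP inj : #|[set two_path_class (r i) | i in 'I_(beta G)]|
      == #|'I_(beta G)| by rewrite v_repr card_ord.
  by move=> i j; apply: inj.
have xiE i j : xi R (r i) (inl (r j)) = (i == j)%:R.
  by rewrite xi_inl (inj_eq cls_inj).
have AP x := @mem_abelian_factor G R A x hD hA.
rewrite /basis_of andbC; apply/andP; split.
  have -> : [seq xi R (r i) | i : 'I_(beta G)] = mktuple (fun i => xi R (r i)).
    by [].
  (* Evaluating at the j-th representative isolates the j-th coefficient. *)
  apply/freeP => k k0 j.
  have := congr1 (fun x : {ffun _ -> _} => x (inl (r j))) k0.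
  rewrite sum_ffunE ffunE (bigD1 j) //= big1 => [|i /negPf ij].
    by rewrite nth_mktuple ffunE xiE eqxx addr0 => <-; rewrite [RHS]mulr1.
  by rewrite nth_mktuple ffunE xiE ij scaler0.
rewrite eqEsubv; apply/andP; split.
  apply/span_subvP => _ /imageP[i _ ->]; apply/AP.
  by split; [exact: xi_vspan | exact: xi_in_center].
apply/subvP => x /AP[xv /in_center_two_pathP xconst].
(* The coordinate of x on the indicator of a class is its common value there,
   read off at the representative. *)
have -> : x = \sum_i (x (inl (r i)) : R) *: xi R (r i).
  apply/ffunP => -[w|Z]; rewrite sum_ffunE; last first.
    rewrite vspan_eq0 // big1 // => i _.
    by rewrite ffunE vspan_eq0 ?scaler0 ?xi_vspan.
  have : two_path_class w \in two_path_classes G by apply: imset_f.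
  rewrite -v_repr => /imsetP[j _ wj].
  rewrite (bigD1 j) //= big1 => [|i /negPf ij].
    rewrite ffunE xi_inl wj eqxx addr0 [RHS]mulr1; apply: xconst.
    have : w \in two_path_class (r j) by rewrite in_two_path_class wj.
    by rewrite inE.
  by rewrite ffunE xi_inl wj (inj_eq cls_inj) ij scaler0.
by apply: memv_suml => i _; apply/memvZ/memv_span/imageP; exists i.
Qed.
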